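(* If $j$ and $k$ are (topological) jump operators and $j\dashv k$, then $\langle j,id\rangle$-realizability is equivalent to $\langle id,k\rangle$-realizability; that is, for every function $f\colon X\to Y$ between represented spaces, $f$ is $\langle j,id\rangle$-realizable if and only if $f$ is $\langle id,k\rangle$-realizable.
   Context: $\omega^\omega$ is Baire space, $id\colon\omega^\omega\to\omega^\omega$ its identity function; $\subseteq$ in $F\colon\subseteq A\to B$ indicates a partial function. Equations between compositions of partial functions are equalities of partial functions (same domain, same values). A partial function on $\omega^\omega$ is continuous if it is continuous on its domain with the subspace topology. A represented space is a pair $\langle X,\rho_X\rangle$ with $X$ a set and $\rho_X\colon\subseteq\omega^\omega\to X$ a surjective partial function. A (topological) jump operator is a partial surjective function $j\colon\subseteq\omega^\omega\to\omega^\omega$ such that for every partial continuous $F\colon\subseteq\omega^\omega\to\omega^\omega$ there is a partial continuous $F'\colon\subseteq\omega^\omega\to\omega^\omega$ with $F\circ j=j\circ F'$. For jump operators $j,k$: $j\leq k$ iff $j=k\circ F$ for some partial continuous $F\colon\subseteq\omega^\omega\to\omega^\omega$. $j$ is left adjoint to $k$, written $j\dashv k$, iff $k\circ j\leq id\leq j\circ k$. Given jump operators $j,k$, represented spaces $\langle X,\rho_X\rangle$, $\langle Y,\rho_Y\rangle$ and a function $f\colon X\to Y$, a function $F\colon\subseteq\omega^\omega\to\omega^\omega$ $\langle j,k\rangle$-realizes $f$ iff $f\circ\rho_X\circ j=\rho_Y\circ k\circ F$. $f$ is $\langle j,k\rangle$-realizable iff it has a (partial) continuous $\langle j,k\rangle$-realizer.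 *)

(* Defs.v *)
From HB Require Import structures.
From mathcomp Require Import all_boot all_classical topology.

Set Implicit Arguments.
Unset Strict Implicit.
Unset Printing Implicit Defensive.

Local Open Scope classical_set_scope.

(* The product topology; nat carries its discrete topology here. *)
Definition baire : Type := prod_topology (fun _ : nat => nat).

HB.instance Definition _ := Pointed.on baire.
HB.instance Definition _ := Topological.on baire.

(* A partial function from A to B is a map A -> option B, with None meaning
   "undefined".  Composition is ssrfun's pcomp, and equality of partial
   functions (same domain, same values) is =1. *)
Definition partial (A B : Type) := A -> option B.

Definition pid : partial baire baire := fun p => Some p.

Definition pdom (A B : Type) (F : partial A B) : set A := [set x | F x].

Definition psurjective (A B : Type) (F : partial A B) : Prop :=
  forall y, exists x, F x = Some y.

(* {within _, continuous _} only depends on the values inside the given set,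
   so the default value used outside the domain is irrelevant. *)
Definition pcontinuous (F : partial baire baire) : Prop :=
  {within pdom F, continuous (fun p => odflt point (F p))}.

Record representedSpace := RepresentedSpace {
  rep_carrier :> Type;
  rep : partial baire rep_carrier;
  rep_surj : psurjective rep
}.

Definition jump_operator (j : partial baire baire) : Prop :=
  psurjective j /\
  forall F : partial baire baire, pcontinuous F ->
    exists2 F' : partial baire baire, pcontinuous F' & pcomp F j =1 pcomp j F'.

Definition jump_le (j k : partial baire baire) : Prop :=
  exists2 F : partial baire baire, pcontinuous F & j =1 pcomp k F.

Definition left_adjoint (j k : partial baire baire) : Prop :=
  jump_le (pcomp k j) pid /\ jump_le pid (pcomp j k).

Definition realizes (j k : partial baire baire) (X Y : representedSpace)
    (F : partial baire baire) (f : X -> Y) : Prop :=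
  omap f \o pcomp (rep X) j =1 pcomp (rep Y) (pcomp k F).

Definition realizable (j k : partial baire baire) (X Y : representedSpace)
    (f : X -> Y) : Prop :=
  exists2 F : partial baire baire, pcontinuous F & realizes j k F f.

(* Main.v *)
(** Continuous partial functions compose, so it suffices to find the realizers.
    Write [k o j = G] and [id = j o k o H] with [G], [H] continuous.  If
    [f o rho_X o j = rho_Y o F], then
    [f o rho_X = f o rho_X o j o k o H = rho_Y o F o k o H], and the jump
    property of [k] moves [F] to the right of [k].  Conversely, if
    [f o rho_X = rho_Y o k o F], then [f o rho_X o j = rho_Y o k o F o j], the
    jump property of [j] gives [F o j = j o F'], and [k o j = G]. *)
From mathcomp Require Import all_boot all_classical topology.
Require Import Defs.

Set Implicit Arguments.
Unset Strict Implicit.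
Unset Printing Implicit Defensive.

Local Open Scope classical_set_scope.

Lemma pcompA (A B C D : Type) (f : partial C D) (g : partial B C)
    (h : partial A B) :
  pcomp f (pcomp g h) = pcomp (pcomp f g) h.
Proof. by apply/funext => x; rewrite /pcomp; case: (h x). Qed.

Lemma pcomp_pid (B : Type) (f : partial baire B) : pcomp f pid = f.
Proof. exact/funext. Qed.

Lemma pid_pcomp (A : Type) (f : partial A baire) : pcomp pid f = f.
Proof. by apply/funext => x; rewrite /pcomp; case: (f x). Qed.

(** Absorbing the total map into the left factor leaves pure composites that [pcompA] can
    regroup. *)
Lemma omap_pcomp (A B C D : Type) (f : C -> D) (g : partial B C)
    (h : partial A B) :
  omap f \o pcomp g h = pcomp (omap f \o g) h.
Proof. by apply/funext => x; rewrite /pcomp /=; case: (h x). Qed.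

Lemma pcontinuous_pcomp (F G : partial baire baire) :
  pcontinuous F -> pcontinuous G -> pcontinuous (pcomp F G).
Proof.
move=> /subspace_continuousP cF /subspace_continuousP cG.
apply/subspace_continuousP => x; rewrite /pdom /pcomp /from_subspace /=.
case Gx: (G x) => [y|//] /= Fy U nU.
have domGx : pdom G x by rewrite /pdom /= Gx.
(* By continuity of [F] at [y], the points where [F] is undefined or has its value in [U] form a
   neighbourhood of [y]; [G] pulls it back. *)
have := cG x domGx; rewrite /from_subspace Gx => /(_ _ (cF y Fy U nU)).
rewrite !nbhs_simpl /= /within /=; apply: filterS => z.
by rewrite /pdom /=; case: (G z) => [w|//] /= /(_ isT).
Qed.

Theorem theorem15 (j k : partial baire baire)
    (hj : jump_operator j) (hk : jump_operator k) (hjk : left_adjoint j k)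
    (X Y : representedSpace) (f : X -> Y) :
  realizable j pid f <-> realizable pid k f.
Proof.
case: hj hk hjk => [_ jumpj] [_ jumpk] [[G cG /funext]].
rewrite pid_pcomp => kjG [H cH /funext idH].
split=> -[F cF /funext]; rewrite omap_pcomp.
- rewrite pid_pcomp => fF.
  have [F' cF' /funext FkF'] := jumpk _ cF.
  (* Since [F o k = k o F'], the tail [F o k o H] is [k o F' o H]. *)
  exists (pcomp F' H); first exact: pcontinuous_pcomp.
  move=> p; rewrite omap_pcomp {1}idH -(pcompA j) (pcompA _ j) fF -(pcompA _ F).
  by rewrite (pcompA F) FkF' -(pcompA k).
- rewrite pcomp_pid => fF.
  have [F' cF' /funext FjF'] := jumpj _ cF.
  (* Here [k o F o j = k o j o F' = G o F'], so no jump remains in front. *)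
  exists (pcomp G F'); first exact: pcontinuous_pcomp.
  move=> p; rewrite omap_pcomp fF pid_pcomp -(pcompA _ _ j) -(pcompA k) FjF'.
  by rewrite (pcompA k) kjG.
Qed.
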